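(* Consider the data setting, the set $\Sigma_c$, and the matrix $P_c$ defined in the context. Suppose that $P_c$ is invertible and has exactly $m_d$ positive eigenvalues. Let $K\in\mathbb{R}^{m\times n}$ and $h>0$. Suppose there exist scalars $\tilde\lambda_1>0$, $\tilde\lambda_2>0$, symmetric matrices $Q_1\succ 0$, $R\succ 0$ in $\mathbb{R}^{n\times n}$, and matrices $Q_2,Q_3\in\mathbb{R}^{n\times n}$ with $Q_3+Q_3^\top\succ 0$ such that, with $$Q=\begin{bmatrix} Q_1 & 0 \\ Q_2 & Q_3 \end{bmatrix},\qquad Q_R=\mathrm{diag}(Q,R),\qquad \bar Q_R=\mathrm{diag}(Q,R^{-1}),$$ the following two matrix inequalities hold: $$G_1^\top\begin{bmatrix} 0 & Q_R^\top & 0 \\ Q_R & 0 & 0 \\ 0 & 0 & \tilde\lambda_1P_c \end{bmatrix}G_1\prec 0,\qquad G_1=\begin{bmatrix} I_{3n} & 0 \\ \begin{bmatrix} 0 & 0 & 0 \\ I & -I & R \\ 0 & 0 & -\tfrac{1}{2h}I \end{bmatrix} & \begin{bmatrix} I & K^\top \\ 0 & 0 \\ 0 & 0 \end{bmatrix} \\ 0 & I_{n+m} \\ \begin{bmatrix} 0 & I & 0 \end{bmatrix} & \begin{bmatrix} 0 & 0 \end{bmatrix} \end{bmatrix},$$ $$G_2^\top\begin{bmatrix} 0 & \bar Q_R^\top & 0 \\ \bar Q_R & 0 & 0 \\ 0 & 0 & \tilde\lambda_2P_c \end{bmatrix}G_2\prec 0,\qquad G_2=\begin{bmatrix} I_{3n}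 & 0 \\ \begin{bmatrix} 0 & 0 & 0 \\ I & -I & 0 \\ 0 & 0 & -\tfrac12 hI \end{bmatrix} & \begin{bmatrix} I & K^\top \\ 0 & 0 \\ 0 & -hK^\top \end{bmatrix} \\ 0 & I_{n+m} \\ \begin{bmatrix} 0 & I & 0 \end{bmatrix} & \begin{bmatrix} 0 & 0 \end{bmatrix} \end{bmatrix}.$$ Then, for every $(A,B)\in\Sigma_c$ and every sampling sequence $\{t_k\}_{k=0}^\infty$ with $t_0=0$, $t_{k+1}-t_k\in(0,h]$ for all $k\in\mathbb{N}_0$, and $\lim_{k\to\infty}t_k=\infty$, the system $\dot x(t)=Ax(t)+Bu(t)$ with sampled-data controller $u(t)=Kx(t_k)$ for $t\in[t_k,t_{k+1})$, $k\in\mathbb{N}_0$, is exponentially stable.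
   Context: Data setting. Let $n,m,m_d,N$ be positive integers. The columns of $\dot X=[\dot x(\tau_1)\ \cdots\ \dot x(\tau_N)]\in\mathbb{R}^{n\times N}$, $X=[x(\tau_1)\ \cdots\ x(\tau_N)]\in\mathbb{R}^{n\times N}$, $U=[u(\tau_1)\ \cdots\ u(\tau_N)]\in\mathbb{R}^{m\times N}$ are measurements, at not necessarily equidistant times $\tau_1,\dots,\tau_N$, of a system $\dot x(t)=A_{\mathrm{tr}}x(t)+B_{\mathrm{tr}}u(t)+B_dd(t)$ with unknown $A_{\mathrm{tr}}\in\mathbb{R}^{n\times n}$, $B_{\mathrm{tr}}\in\mathbb{R}^{n\times m}$ and unknown disturbance; that is, $\dot X=A_{\mathrm{tr}}X+B_{\mathrm{tr}}U+B_d\hat D$ for some (unknown) $\hat D\in\mathcal{D}$. The matrix $B_d\in\mathbb{R}^{n\times m_d}$ is known and has full column rank. The noise set is $$\mathcal{D}=\left\{D\in\mathbb{R}^{m_d\times N}\ \middle|\ \begin{bmatrix} D^\top \\ I \end{bmatrix}^\top\begin{bmatrix} Q_d & S_d \\ S_d^\top & R_d \end{bmatrix}\begin{bmatrix} D^\top \\ I \end{bmatrix}\succeq 0\right\},$$ with given symmetric $Q_d\in\mathbb{R}^{N\times N}$, symmetric $R_d\in\mathbb{R}^{m_d\times m_d}$, $S_d\in\mathbb{R}^{N\times m_d}$, and $Q_d\prec 0$. The set of systems consistent with the data is $\Sigma_c=\{(A,B)\in\mathbb{R}^{n\times n}\times\mathbb{R}^{n\times m}\mid \exists D\in\mathcal{D}:\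 \dot X=AX+BU+B_dD\}$. With $Z=\begin{bmatrix} X \\ U \end{bmatrix}\in\mathbb{R}^{(n+m)\times N}$, define $$P_c=\begin{bmatrix} -Z & 0 \\ \dot X & B_d \end{bmatrix}\begin{bmatrix} Q_d & S_d \\ S_d^\top & R_d \end{bmatrix}\begin{bmatrix} -Z & 0 \\ \dot X & B_d \end{bmatrix}^\top\in\mathbb{R}^{(2n+m)\times(2n+m)}.$$ For symmetric matrices, $\succ,\succeq,\prec,\preceq$ denote positive definite, positive semidefinite, negative definite, negative semidefinite. $I$ and $0$ are identity and zero matrices of appropriate size ($n\times n$ for the unsubscripted $I$ inside $G_1,G_2$). $\mathbb{N}_0$ is the set of nonnegative integers. Exponential stability of the closed loop is meant in the usual sense: there are constants $c,\alpha>0$ such that $\|x(t)\|\le c e^{-\alpha t}\|x(0)\|$ for all $t\ge 0$ and all initial conditions $x(0)\in\mathbb{R}^n$. *)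

(* Defs.v *)
From HB Require Import structures.
From mathcomp Require Import all_boot all_order all_algebra.
From mathcomp Require Import polyrcf.
From mathcomp Require Import all_classical all_reals all_analysis.

Set Implicit Arguments.
Unset Strict Implicit.
Unset Printing Implicit Defensive.

Import Order.TTheory GRing.Theory Num.Theory.
Import numFieldNormedType.Exports.

Local Open Scope classical_set_scope.
Local Open Scope ring_scope.

Section MatrixNotions.
Context {R : realType}.

Definition posdefmx n (A : 'M[R]_n) : Prop :=
  A^T = A /\ forall v : 'cV[R]_n, v != 0 -> 0 < (v^T *m A *m v) 0 0.

Definition possemidefmx n (A : 'M[R]_n) : Prop :=
  A^T = A /\ forall v : 'cV[R]_n, 0 <= (v^T *m A *m v) 0 0.

Definition negdefmx n (A : 'M[R]_n) : Prop := posdefmx (- A).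

(* Counted with algebraic multiplicity: [rootsR] lists every real root once. *)
Definition num_pos_eigenvalues n (A : 'M[R]_n) : nat :=
  (\sum_(a <- rootsR (char_poly A) | (0 < a)%R) mup a (char_poly A))%N.

Definition enorm n (v : 'cV[R]_n) : R := Num.sqrt ((v^T *m v) 0 0).

Definition block3_mx m1 m2 m3 n1 n2 n3
    (A11 : 'M[R]_(m1, n1)) (A12 : 'M[R]_(m1, n2)) (A13 : 'M[R]_(m1, n3))
    (A21 : 'M[R]_(m2, n1)) (A22 : 'M[R]_(m2, n2)) (A23 : 'M[R]_(m2, n3))
    (A31 : 'M[R]_(m3, n1)) (A32 : 'M[R]_(m3, n2)) (A33 : 'M[R]_(m3, n3)) :
    'M[R]_(m1 + m2 + m3, n1 + n2 + n3) :=
  block_mx (block_mx A11 A12 A21 A22) (col_mx A13 A23)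
           (row_mx A31 A32)           A33.

End MatrixNotions.

Section Data.
Context {R : realType} {n m md N : nat}.
Variables (Xdot X : 'M[R]_(n, N)) (U : 'M[R]_(m, N)) (Bd : 'M[R]_(n, md)).
Variables (Qd : 'M[R]_N) (Sd : 'M[R]_(N, md)) (Rd : 'M[R]_md).

Definition noise_mx : 'M[R]_(N + md) := block_mx Qd Sd Sd^T Rd.

Definition noise_set : set 'M[R]_(md, N) :=
  [set D | possemidefmx ((col_mx D^T 1%:M)^T *m noise_mx *m col_mx D^T 1%:M)].

Definition consistent_systems : set ('M[R]_n * 'M[R]_(n, m)) :=
  [set AB | exists2 D, noise_set D &
     Xdot = AB.1 *m X + AB.2 *m U + Bd *m D].

Definition data_mx : 'M[R]_(n + m + n) :=
  let F : 'M[R]_(n + m + n, N + md) := block_mx (- col_mx X U) 0 Xdot Bd in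
  F *m noise_mx *m F^T.

End Data.

Section Inequalities.
Context {R : realType} {n m : nat}.

Definition outer_mx (M : 'M[R]_(n + n + n)) (L : 'M[R]_(n + n + n, n + m)) :
    'M[R]_((n + n + n) + (n + n + n) + (n + m + n), (n + n + n) + (n + m)) :=
  col_mx (block_mx 1%:M 0
                   M    L)
         (block_mx 0                         1%:M
                   (row_mx (row_mx 0 1%:M) 0) (row_mx 0 0)).

Definition G1 (W : 'M[R]_n) (K : 'M[R]_(m, n)) (h : R) :=
  outer_mx
    (block3_mx 0    0         0
               1%:M (- 1%:M)  W
               0    0         (- ((2 * h)^-1 *: 1%:M)))
    (col_mx (block_mx 1%:M K^T
                      0    0)
            (row_mx   0    0)).

Definition G2 (K : 'M[R]_(m, n)) (h : R) :=
  outer_mx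
    (block3_mx 0    0         0
               1%:M (- 1%:M)  0
               0    0         (- ((h / 2) *: 1%:M)))
    (col_mx (block_mx 1%:M K^T
                      0    0)
            (row_mx   0    (- (h *: K^T)))).

Definition inner_mx (Q : 'M[R]_(n + n)) (W : 'M[R]_n) (lambda : R)
    (P : 'M[R]_(n + m + n)) :
    'M[R]_((n + n + n) + (n + n + n) + (n + m + n)) :=
  let QW : 'M[R]_(n + n + n) := block_mx Q 0 0 W in
  block3_mx 0  QW^T 0
            QW 0    0
            0  0    (lambda *: P).

End Inequalities.

Section SampledData.
Context {R : realType} {n m : nat}.

Definition sampling_sequence (h : R) (t : nat -> R) : Prop :=
  [/\ t 0%N = 0,
      forall k, 0 < t k.+1 - t k <= h &
      t k @[k --> \oo] --> +oo].

(* As [u] jumps at the sampling times, the differential equation is imposed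
   between them only, and [x] is required to be continuous on [0, +oo[. *)
Definition closed_loop_solution (A : 'M[R]_n) (B : 'M[R]_(n, m))
    (K : 'M[R]_(m, n)) (t : nat -> R) (x : R -> 'cV[R]_n) (u : R -> 'cV[R]_m) :
    Prop :=
  [/\ {within `[0, +oo[, continuous x},
      forall (k : nat) (s : R), t k <= s < t k.+1 -> u s = K *m x (t k) &
      forall (k : nat) (s : R), t k < s < t k.+1 ->
        is_derive s 1 x (A *m x s + B *m u s)].

Definition exponentially_stable (A : 'M[R]_n) (B : 'M[R]_(n, m))
    (K : 'M[R]_(m, n)) (t : nat -> R) : Prop :=
  exists c alpha : R,
    [/\ 0 < c, 0 < alpha &
        forall x u, closed_loop_solution A B K t x u ->
        forall s : R, 0 <= s ->
          enorm (x s) <= c * expR (- alpha * s) * enorm (x 0)].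

End SampledData.

(* Main.v *)
Require Import Defs.
From HB Require Import structures.
From mathcomp Require Import all_boot all_order all_algebra.
From mathcomp Require Import polyrcf ring lra.
From mathcomp Require Import all_classical all_reals all_analysis.

Set Implicit Arguments.
Unset Strict Implicit.
Unset Printing Implicit Defensive.

Import Order.TTheory GRing.Theory Num.Theory.
Import numFieldNormedType.Exports.

Local Open Scope classical_set_scope.
Local Open Scope ring_scope.

                                                                                 
                                                                             
                                                                          
                                                                       
                                           
                                              
                                                                      
                                         
                                                                               
                                                                                  
                                                   

(** On a sampling interval starting at a, put tau = s - a, e = x(s) - x(a), y = x'(s), and let v = e
    / tau be the mean velocity. The Lyapunov function is V = x^T Q1^-1 x + (h - tau) tau v^T W v.
    Its second term vanishes as tau tends to 0 and is nonnegative up to tau = h, so V equals x^T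
    Q1^-1 x at a and dominates it afterwards. Hence V' <= - al V gives decay of x^T Q1^-1 x over
    each interval ([interval_decay]). The rate al does not depend on the interval, so these
    estimates chain along the sampling times.

    Since 2 v^T W y <= y^T W y + v^T W v, the derivative satisfies V' <= 2 x^T Q1^-1 y + (h - tau)
    y^T W y - tau v^T W v. That this is at most - al V is [sampled_dissipation], a purely algebraic
    fact. The two matrix inequalities are its versions at tau = 0 and tau = h, in the dual variables
    z with x = Q1 z1 and y = Q2 z1 + Q3 z2 (descriptor form). They are combined with weights 1 -
    tau/h and tau/h.

    The data enter as in the S-procedure: if (A,B) is consistent, the form of P_c is nonnegative at
    (A^T z2, B^T z2, z2) ([consistent_data_mx_ge0]). Its positive multiple can then be dropped from
    each inequality, leaving a bound for the actual A and B. *)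

(** * Bilinear forms and domination by a positive definite form *)

Section BilinearForm.
Context {R : realType}.

Definition bform m n (M : 'M[R]_(m, n)) (u : 'cV[R]_m) (v : 'cV[R]_n) : R :=
  (u^T *m M *m v) 0 0.

Section Bilinearity.
Context {m n : nat}.
Implicit Types (M : 'M[R]_(m, n)) (u : 'cV[R]_m) (v : 'cV[R]_n) (a : R).

Lemma bformDl M u u' v : bform M (u + u') v = bform M u v + bform M u' v.
Proof. by rewrite /bform linearD /= !mulmxDl mxE. Qed.

Lemma bformDr M u v v' : bform M u (v + v') = bform M u v + bform M u v'.
Proof. by rewrite /bform mulmxDr mxE. Qed.

Lemma bformZl M a u v : bform M (a *: u) v = a * bform M u v.
Proof. by rewrite /bform linearZ /= -!scalemxAl mxE. Qed.

Lemma bformZr M a u v : bform M u (a *: v) = a * bform M u v.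
Proof. by rewrite /bform -scalemxAr mxE. Qed.

Lemma bformNl M u v : bform M (- u) v = - bform M u v.
Proof. by rewrite -scaleN1r bformZl mulN1r. Qed.

Lemma bformNr M u v : bform M u (- v) = - bform M u v.
Proof. by rewrite -scaleN1r bformZr mulN1r. Qed.

Lemma bform0l M v : bform M 0 v = 0.
Proof. by have := bformZl M 0 0 v; rewrite scale0r mul0r. Qed.

Lemma bform0m u v : bform (0 : 'M[R]_(m, n)) u v = 0.
Proof. by rewrite /bform mulmx0 mul0mx mxE. Qed.

Lemma bformZm M a u v : bform (a *: M) u v = a * bform M u v.
Proof. by rewrite /bform -scalemxAr -scalemxAl mxE. Qed.

Lemma bformNm M u v : bform (- M) u v = - bform M u v.
Proof. by rewrite -scaleN1r bformZm mulN1r. Qed.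

Lemma bform_tr M u v : bform M u v = bform M^T v u.
Proof.
have -> : bform M u v = (u^T *m M *m v)^T 0 0 by rewrite [RHS]mxE.
by rewrite !trmx_mul trmxK mulmxA.
Qed.

Lemma bformE M u v : bform M u v = \sum_i \sum_j u i 0 * M i j * v j 0.
Proof.
rewrite /bform mxE exchange_big /=; apply: eq_bigr => j _.
by rewrite !mxE mulr_suml; apply: eq_bigr => i _; rewrite !mxE.
Qed.

Lemma bform_mull p (C : 'M[R]_(m, p)) M (u : 'cV_p) v :
  bform M (C *m u) v = bform (C^T *m M) u v.
Proof. by rewrite /bform trmx_mul !mulmxA. Qed.

Lemma bform_mulr p (C : 'M[R]_(n, p)) M u (v : 'cV_p) :
  bform M u (C *m v) = bform (M *m C) u v.
Proof. by rewrite /bform !mulmxA. Qed.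

End Bilinearity.

Definition bform_lin := (@bformDl, @bformDr, @bformNl, @bformNr, @bformZl, @bformZr).

Lemma bform_block m1 m2 n1 n2 (M11 : 'M[R]_(m1, n1)) (M12 : 'M[R]_(m1, n2))
    (M21 : 'M[R]_(m2, n1)) (M22 : 'M[R]_(m2, n2)) u1 u2 v1 v2 :
  bform (block_mx M11 M12 M21 M22) (col_mx u1 u2) (col_mx v1 v2) =
  bform M11 u1 v1 + bform M12 u1 v2 + (bform M21 u2 v1 + bform M22 u2 v2).
Proof.
rewrite /bform tr_col_mx mul_row_block mul_row_col !mulmxDl !mxE.
by rewrite -!addrA; congr (_ + _); rewrite addrCA.
Qed.

Lemma bform_col m1 m2 n (M1 : 'M[R]_(m1, n)) (M2 : 'M[R]_(m2, n)) u1 u2 v :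
  bform (col_mx M1 M2) (col_mx u1 u2) v = bform M1 u1 v + bform M2 u2 v.
Proof. by rewrite /bform tr_col_mx mul_row_col mulmxDl mxE. Qed.

Lemma bform_row m n1 n2 (M1 : 'M[R]_(m, n1)) (M2 : 'M[R]_(m, n2)) u v1 v2 :
  bform (row_mx M1 M2) u (col_mx v1 v2) = bform M1 u v1 + bform M2 u v2.
Proof. by rewrite /bform mul_mx_row mul_row_col mxE. Qed.

Lemma bform_sym n (M : 'M[R]_n) u v : M^T = M -> bform M u v = bform M v u.
Proof. by move=> sM; rewrite bform_tr sM. Qed.

Lemma posdefmx_ge0 n (M : 'M[R]_n) v : posdefmx M -> 0 <= bform M v v.
Proof.
move=> [_ M0]; have [->|v0] := eqVneq v 0; first by rewrite bform0l.
exact/ltW/M0.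
Qed.

Lemma bform_gt0_unitmx n (M : 'M[R]_n) :
  (forall v, v != 0 -> 0 < bform M v v) -> M \in unitmx.
Proof.
move=> M0; rewrite unitmxE unitfE; apply/negP => /det0P[v v0 vM].
have /M0 : v^T != 0 by rewrite trmx_eq0.
by rewrite /bform trmxK vM mul0mx mxE ltxx.
Qed.

Lemma posdefmx_unitmx n (M : 'M[R]_n) : posdefmx M -> M \in unitmx.
Proof. by move=> [_ M0]; exact: bform_gt0_unitmx. Qed.

Lemma bform_CauchySchwarz n (M : 'M[R]_n) u v : posdefmx M ->
  (bform M u v) ^+ 2 <= bform M u u * bform M v v.
Proof.
move=> PM; have [->|u0] := eqVneq u 0; first by rewrite !bform0l expr0n mul0r.
have uu : 0 < bform M u u by case: PM => _; apply.
have := posdefmx_ge0 (bform M u u *: v - bform M u v *: u) PM.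
rewrite !bform_lin (bform_sym v u PM.1).
set a := bform M u u in uu *; set b := bform M u v; set c := bform M v v.
move=> h; suff : 0 <= a * (a * c - b ^+ 2) by rewrite pmulr_rge0 // subr_ge0.
by lra.
Qed.

Lemma bform_bound n (M : 'M[R]_n) (u : 'cV[R]_n) C :
  (forall i, `|u i 0| <= C) ->
  `|bform M u u| <= (\sum_i \sum_j `|M i j|) * C ^+ 2.
Proof.
move=> uC; rewrite bformE mulr_suml (le_trans (ler_norm_sum _ _ _)) //.
apply: ler_sum => i _; rewrite mulr_suml (le_trans (ler_norm_sum _ _ _)) //.
apply: ler_sum => j _; rewrite !normrM -mulrA mulrCA ler_wpM2l // expr2.
by apply: ler_pM.
Qed.

(** This turns strict definiteness into a quantitative margin, without eigenvalues or compactness.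
    Each coordinate is an M-inner product v_i = <w_i, v>, so Cauchy-Schwarz bounds it by the M-norm
    of v. *)
Lemma posdefmx_dominates n (M S : 'M[R]_n) : posdefmx M ->
  exists2 c, 0 < c & forall v, bform S v v <= c * bform M v v.
Proof.
move=> PM; have uM := posdefmx_unitmx PM.
pose w i : 'cV[R]_n := invmx M *m delta_mx i 0.
have wE i (v : 'cV[R]_n) : bform M (w i) v = v i 0.
  rewrite (bform_sym _ _ PM.1) bform_mulr mulmxV // /bform mulmx1 -colE.
  by rewrite !mxE.
pose a := \sum_i bform M (w i) (w i).
have a0 : 0 <= a by apply: sumr_ge0 => i _; exact: posdefmx_ge0.
have va (v : 'cV[R]_n) i : `|v i 0| <= Num.sqrt (a * bform M v v).
  rewrite -sqrtr_sqr ler_sqrt; last by rewrite mulr_ge0 ?posdefmx_ge0.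
  rewrite -(wE i) (le_trans (bform_CauchySchwarz _ _ PM)) //.
  rewrite ler_wpM2r ?posdefmx_ge0 // /a (bigD1 i) //= lerDl.
  by apply: sumr_ge0 => j _; exact: posdefmx_ge0.
pose s := \sum_i \sum_j `|S i j|.
have s0 : 0 <= s by apply: sumr_ge0 => i _; apply: sumr_ge0.
(* The added 1 only makes the constant strictly positive. *)
exists (s * a + 1); first by rewrite ltr_wpDl ?mulr_ge0.
move=> v; rewrite (le_trans (ler_norm _)) //.
rewrite (le_trans (bform_bound S (va v))) //.
rewrite sqr_sqrtr ?mulr_ge0 ?posdefmx_ge0 // mulrA ler_wpM2r ?posdefmx_ge0 //.
by rewrite lerDl.
Qed.

End BilinearForm.

(** * What consistency with the data gives about P_c *)

Section DataMatrix.
Context {R : realType} {n m md N : nat}.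
Variables (Xdot X : 'M[R]_(n, N)) (U : 'M[R]_(m, N)) (Bd : 'M[R]_(n, md)).
Variables (Qd : 'M[R]_N) (Sd : 'M[R]_(N, md)) (Rd : 'M[R]_md).

(** With F the outer factor of [data_mx], the data equation gives F^T (A^T p, B^T p, p) = (D^T; I)
    Bd^T p. The form is therefore the noise inequality for D evaluated at Bd^T p. *)
Lemma consistent_data_mx_ge0 A B (p : 'cV[R]_n) :
  consistent_systems Xdot X U Bd Qd Sd Rd (A, B) ->
  0 <= bform (data_mx Xdot X U Bd Qd Sd Rd)
         (col_mx (col_mx (A^T *m p) (B^T *m p)) p)
         (col_mx (col_mx (A^T *m p) (B^T *m p)) p).
Proof.
move=> [D [_ D0] /= XE]; set w := col_mx _ _.
have FE : (block_mx (- col_mx X U) 0 Xdot Bd)^T *m w =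
    col_mx D^T 1%:M *m (Bd^T *m p).
  rewrite tr_block_mx mul_block_col mul_col_mx mul1mx trmx0 mul0mx add0r.
  congr col_mx; rewrite linearN /= tr_col_mx mulNmx mul_row_col.
  rewrite XE !linearD /= !trmx_mul !mulmxDl !mulmxA.
  by rewrite -!opprD addKr.
rewrite [leRHS](_ : _ = bform (noise_mx Qd Sd Rd)
  (col_mx D^T 1%:M *m (Bd^T *m p)) (col_mx D^T 1%:M *m (Bd^T *m p))); last first.
  by rewrite -FE [RHS]bform_mull bform_mulr trmxK.
rewrite bform_mull bform_mulr; exact: D0.
Qed.

End DataMatrix.

(** * The two matrix inequalities as quadratic forms *)

Section MatrixInequalities.
Context {R : realType} {n m : nat}.
Implicit Types (z : 'cV[R]_n) (w : 'cV[R]_(n + m)).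

Lemma outer_mxE M (L : 'M[R]_(n + n + n, n + m)) z1 z2 z3 w :
  let z := col_mx (col_mx z1 z2) z3 in
  outer_mx M L *m col_mx z w =
  col_mx (col_mx z (M *m z + L *m w)) (col_mx w z2).
Proof.
move=> z; rewrite /outer_mx mul_col_mx !mul_block_col !mul_row_col.
by rewrite row_mx0 !mul1mx !mul0mx !addr0 !add0r.
Qed.

Lemma bform_inner_mx (Q : 'M[R]_(n + n)) S l (P : 'M[R]_(n + m + n)) a b c :
  bform (inner_mx Q S l P) (col_mx (col_mx a b) c) (col_mx (col_mx a b) c) =
  2 * bform (block_mx Q 0 0 S) b a + l * bform P c c.
Proof.
rewrite /inner_mx /block3_mx bform_block bform_block bform_col bform_row.
rewrite !bform0m !add0r !addr0 -bform_tr bformZm.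
by rewrite -mulr2n mulr_natl.
Qed.

Lemma mul_block3_col m1 m2 m3 n1 n2 n3
    (A11 : 'M[R]_(m1, n1)) (A12 : 'M[R]_(m1, n2)) (A13 : 'M[R]_(m1, n3))
    (A21 : 'M[R]_(m2, n1)) (A22 : 'M[R]_(m2, n2)) (A23 : 'M[R]_(m2, n3))
    (A31 : 'M[R]_(m3, n1)) (A32 : 'M[R]_(m3, n2)) (A33 : 'M[R]_(m3, n3))
    (v1 : 'cV[R]_n1) (v2 : 'cV[R]_n2) (v3 : 'cV[R]_n3) :
  block3_mx A11 A12 A13 A21 A22 A23 A31 A32 A33 *m
    col_mx (col_mx v1 v2) v3 =
  col_mx (col_mx (A11 *m v1 + A12 *m v2 + A13 *m v3)
                 (A21 *m v1 + A22 *m v2 + A23 *m v3))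
         (A31 *m v1 + A32 *m v2 + A33 *m v3).
Proof.
by rewrite /block3_mx !mul_block_col mul_row_col mul_col_mx add_col_mx.
Qed.

Section Forms.
Variables (A : 'M[R]_n) (B : 'M[R]_(n, m)) (K : 'M[R]_(m, n)) (h l : R).
Variables (P : 'M[R]_(n + m + n)) (W Q1 Q2 Q3 : 'M[R]_n).
Variables (z1 z2 : 'cV[R]_n).
Let w := col_mx (A^T *m z2) (B^T *m z2).
Let y := Q2 *m z1 + Q3 *m z2.

(** Taking w = (A^T z2, B^T z2) as last block turns the row (I, K^T) into (A + B K)^T z2, so the
    unknown system matrices appear. The first summand is the descriptor multiplier z2 applied to the
    residual (A + B K) x - y, where x = Q1 z1. *)
Lemma G1_form z3 :
  let v := col_mx (col_mx (col_mx z1 z2) z3) w in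
  bform ((G1 W K h)^T *m inner_mx (block_mx Q1 0 Q2 Q3) W l P *m G1 W K h) v v =
  2 * (bform 1%:M z2 (A *m (Q1 *m z1) + B *m (K *m (Q1 *m z1)) - y)
       + bform 1%:M z1 y + bform W^T z3 y - (2 * h)^-1 * bform W z3 z3)
  + l * bform P (col_mx w z2) (col_mx w z2).
Proof.
move=> v; rewrite -bform_mulr -bform_mull /v outer_mxE bform_inner_mx.
congr (2 * _ + _).
rewrite /w mul_block3_col !mul_col_mx !mul_row_col.
rewrite !(mul0mx, mul1mx, add0r, addr0, mulNmx, add_col_mx) -scalemxAl mul1mx.
rewrite !bform_block !bform0m /y.
rewrite !(bform_lin, bform_mull, bform_mulr, mulmx1, mul1mx, trmx_mul, trmxK,
  trmx1, addr0, add0r, mulmxA, bform0m).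
lra.
Qed.

(** Writing the third block as W v3 cancels the inverse of W and makes v3 a velocity, like y. *)
Lemma G2_form v3 : W \in unitmx ->
  let v := col_mx (col_mx (col_mx z1 z2) (W *m v3)) w in
  bform ((G2 K h)^T *m inner_mx (block_mx Q1 0 Q2 Q3) (invmx W) l P *m G2 K h)
    v v =
  2 * (bform 1%:M z2 (A *m (Q1 *m z1) + B *m (K *m (Q1 *m z1))
                      - h *: (B *m (K *m v3)) - y)
       + bform 1%:M z1 y - h / 2 * bform W^T v3 v3)
  + l * bform P (col_mx w z2) (col_mx w z2).
Proof.
move=> uW v; rewrite -bform_mulr -bform_mull /v outer_mxE bform_inner_mx.
congr (2 * _ + _).
rewrite /w mul_block3_col !mul_col_mx !mul_row_col.
rewrite !(mul0mx, mul1mx, add0r, addr0, mulNmx, add_col_mx) -!scalemxAl mul1mx.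
rewrite !bform_block !bform0m /y.
rewrite !(bform_lin, bform_mull, bform_mulr, mulmx1, mul1mx, trmx_mul, trmxK,
  trmx1, addr0, add0r, mulmxA, bform0m) -!(mulmxA _ (invmx W)) !mulVmx // ?mulmx1.
lra.
Qed.

End Forms.

End MatrixInequalities.

(** * The dissipation inequality on a sampling interval *)

Section Dissipation.
Context {R : realType} {n m : nat}.
Variables (A : 'M[R]_n) (B : 'M[R]_(n, m)) (K : 'M[R]_(m, n)) (h l1 l2 : R).
Variables (P : 'M[R]_(n + m + n)) (W Q1 Q2 Q3 : 'M[R]_n).

(** The form dominated by both matrix inequalities: it sees only z1 and the third block, hence the
    x-part and the velocity part of V. *)
Let storage_mx : 'M[R]_(n + n + n + (n + m)) :=
  block_mx (block_mx (block_mx Q1 0 0 0) 0 0 (invmx W)) 0 0 0.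

Lemma storage_mxE z1 z2 v3 w : W \in unitmx ->
  bform storage_mx (col_mx (col_mx (col_mx z1 z2) (W *m v3)) w)
                   (col_mx (col_mx (col_mx z1 z2) (W *m v3)) w) =
  bform Q1 z1 z1 + bform W^T v3 v3.
Proof.
move=> uW; rewrite /storage_mx !bform_block !bform0m !(addr0, add0r).
by rewrite bform_mull bform_mulr -mulmxA mulVmx // mulmx1.
Qed.

                                                                             
                                                                                 
                                                                             
                                                                              
(** Here v stands for the mean velocity, so x - tau v is the last sample. The bound is affine in tau
    apart from a cross term in z2 and B K v, whose coefficients are tau in the first inequality and
    tau - h in the second. The weights 1 - tau/h and tau/h cancel that term and interpolate the
    rest. *)
Lemma sampled_dissipation : 0 < h -> 0 < l1 -> 0 < l2 ->
  posdefmx Q1 -> posdefmx W -> posdefmx (Q3 + Q3^T) ->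
  (forall p : 'cV[R]_n,
    0 <= bform P (col_mx (col_mx (A^T *m p) (B^T *m p)) p)
                 (col_mx (col_mx (A^T *m p) (B^T *m p)) p)) ->
  negdefmx ((G1 W K h)^T *m inner_mx (block_mx Q1 0 Q2 Q3) W l1 P *m G1 W K h) ->
  negdefmx ((G2 K h)^T *m inner_mx (block_mx Q1 0 Q2 Q3) (invmx W) l2 P
            *m G2 K h) ->
  exists2 al, 0 < al & forall x v y tau, 0 <= tau <= h ->
    y = A *m x + B *m (K *m (x - tau *: v)) ->
    2 * bform (invmx Q1) x y + (h - tau) * bform W y y - tau * bform W v v
      <= - al * (bform (invmx Q1) x x + (h - tau) * tau * bform W v v).
Proof.
move=> h0 l10 l20 PQ1 PW PQ3 P0 N1 N2.
have uQ1 := posdefmx_unitmx PQ1; have uW := posdefmx_unitmx PW.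
have uQ3 : Q3 \in unitmx.
  apply: bform_gt0_unitmx => v v0; case: PQ3 => _ /(_ v v0).
  rewrite mulmxDr mulmxDl mxE -/(bform Q3 v v) -/(bform Q3^T v v).
  by rewrite -bform_tr; lra.
have [c1 c10 dom1] := posdefmx_dominates storage_mx N1.
have [c2 c20 dom2] := posdefmx_dominates storage_mx N2.
pose c := c1 + c2; have c0 : 0 < c by rewrite addr_gt0.
(* The interpolation yields the margin (x-part + (tau/h) v^T W v) / c. The factor 1 + h^2 pays for
   (h - tau) tau v^T W v <= h^2 (tau/h) v^T W v. *)
exists (c * (1 + h ^+ 2))^-1.
  by rewrite invr_gt0 !mulr_gt0 // ltr_wpDr ?sqr_ge0.
move=> x v y tau /andP[tau0 tauh] yDyn.
(* Solves Q (z1; z2) = (x; y) for the block lower triangular Q. *)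
pose z1 := invmx Q1 *m x; pose z2 := invmx Q3 *m (y - Q2 *m z1).
have xE : Q1 *m z1 = x by rewrite mulmxA mulmxV ?mul1mx.
have yE : Q2 *m z1 + Q3 *m z2 = y.
  by rewrite (mulmxA Q3) mulmxV // mul1mx addrC subrK.
have sQ1 : (invmx Q1)^T = invmx Q1 by rewrite trmx_inv PQ1.1.
have z1y : bform 1%:M z1 y = bform (invmx Q1) x y.
  by rewrite bform_mull sQ1 mulmx1.
have z1z1 : bform Q1 z1 z1 = bform (invmx Q1) x x.
  by rewrite bform_mull bform_mulr sQ1 mulVmx // mul1mx.
pose w := col_mx (A^T *m z2) (B^T *m z2).
(* The third block is h y, the maximiser of z3^T W y - z3^T W z3 / (2 h), with value (h/2) y^T W y.
   It is written W (W^-1 (h y)) to fit [storage_mxE]. *)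
have := dom1 (col_mx (col_mx (col_mx z1 z2) (W *m (invmx W *m (h *: y)))) w).
rewrite storage_mxE // bformNm mulmxA mulmxV // mul1mx G1_form.
have := dom2 (col_mx (col_mx (col_mx z1 z2) (W *m v)) w).
rewrite storage_mxE // bformNm G2_form // -/w.
rewrite xE yE z1y z1z1 PW.1 -/w.
have := P0 z2; rewrite -/w.
have := posdefmx_ge0 (invmx W *m (h *: y)) PW.
have := posdefmx_ge0 v PW.
have : 0 <= bform (invmx Q1) x x by rewrite -z1z1 posdefmx_ge0.
(* The residual of the descriptor equation is the sampling error, (A + B K) x - y = tau B K v. *)
have -> : bform 1%:M z2 (A *m x + B *m (K *m x) - y) =
    tau * bform 1%:M z2 (B *m (K *m v)).
  rewrite -bformZr; congr bform; rewrite yDyn !mulmxBr -!scalemxAr.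
  by rewrite [A *m x + (_ - _)]addrA subKr.
have -> : bform 1%:M z2 (A *m x + B *m (K *m x) - h *: (B *m (K *m v)) - y) =
    (tau - h) * bform 1%:M z2 (B *m (K *m v)).
  rewrite -bformZr; congr bform; rewrite yDyn !mulmxBr -!scalemxAr.
  by rewrite [A *m x + (_ - _)]addrA opprB [LHS]addrC addrA subrK scalerBl.
rewrite !bform_lin.
set qx := bform _ x x; set qv := bform W v v; set qy := bform W y y.
set d := bform _ z2 _; set xy := bform _ x y; set p := bform P _ _.
set q := bform W (invmx W *m _) _.
move=> qx0 qv0 q0 p0 H2 H1.
have hV : (2 * h)^-1 * (h * (h * qy)) = h / 2 * qy.
  by field; rewrite gt_eqF.
rewrite hV in H1.
(* Discards the nonnegative data term r and replaces k by the common constant c. The latter is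
   allowed because the inequality itself forces Y <= 0. *)
have aux k s Y r : 0 < k -> k <= c -> 0 <= s -> 0 <= r ->
    s <= k * - (Y + r) -> s <= c * - Y.
  move=> k0 kc s0 r0 sk; have kr := mulr_ge0 (ltW k0) r0.
  have skY : s <= k * - Y by lra.
  have Y0 : 0 <= - Y by rewrite -(pmulr_rge0 _ k0) (le_trans s0).
  by rewrite (le_trans skY) // ler_wpM2r.
have E1 : qx + q <= c * - (2 * (tau * d + xy + h * qy - h / 2 * qy)).
  apply: aux c10 _ _ _ H1; rewrite ?lerDl ?addr_ge0 ?mulr_ge0 //; exact: ltW.
have E2 : qx + qv <= c * - (2 * ((tau - h) * d + xy - h / 2 * qv)).
  apply: aux c20 _ _ _ H2; rewrite ?lerDr ?addr_ge0 ?mulr_ge0 //; exact: ltW.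
have tauh0 : 0 <= tau / h by rewrite divr_ge0 // ltW.
have tauh1 : 0 <= 1 - tau / h by rewrite subr_ge0 ler_pdivrMr // mul1r.
have {}E1 := ler_wpM2l tauh1 (le_trans (_ : qx <= qx + q) E1).
have {}E1 := E1 (ler_wpDr q0 (lexx _)).
have {}E2 := ler_wpM2l tauh0 E2.
(* The cross terms cancel: (1 - tau/h) tau + (tau/h) (tau - h) = 0. *)
have E : qx + tau / h * qv <=
    c * - (2 * xy + (h - tau) * qy - tau * qv).
  have tauE : tau = tau / h * h by rewrite divfK // gt_eqF.
  move: E1 E2; set r := tau / h in tauE *; rewrite tauE => E1 E2.
  by lra.
rewrite mulNr lerNr mulrC ler_pdivrMr; last first.
  by rewrite mulr_gt0 // ltr_wpDr ?sqr_ge0.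
rewrite [leRHS](_ : _ = (1 + h ^+ 2) *
  (c * - (2 * xy + (h - tau) * qy - tau * qv))); last by ring.
apply: (@le_trans _ _ ((1 + h ^+ 2) * (qx + tau / h * qv))); last first.
  by rewrite ler_wpM2l // addr_ge0 ?sqr_ge0.
have hq : h ^+ 2 * (tau / h * qv) = h * tau * qv by field; rewrite gt_eqF.
have := mulr_ge0 (sqr_ge0 h) qx0.
have := mulr_ge0 tauh0 qv0.
have := mulr_ge0 (sqr_ge0 tau) qv0.
lra.
Qed.

End Dissipation.

(** * Continuity and derivatives of bilinear forms along curves *)

Section Calculus.
Context {R : realType}.

Lemma continuous_coord (T : topologicalType) m n (f : T -> 'M[R]_(m, n)) i j :
  continuous f -> continuous (fun t => f t i j).
Proof.
move=> cf t; apply: (@continuous_comp _ _ _ f (fun M : 'M[R]_(m, n) => M i j)).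
  exact: cf.
exact: coord_continuous.
Qed.

Lemma continuous_bform (T : topologicalType) m n (M : 'M[R]_(m, n))
    (f : T -> 'cV[R]_m) (g : T -> 'cV[R]_n) :
  continuous f -> continuous g -> continuous (fun t => bform M (f t) (g t)).
Proof.
move=> cf cg; under eq_fun do rewrite bformE.
apply: continuous_big => [|i _]; first exact: add_continuous.
apply: continuous_big => [|j _ t]; first exact: add_continuous.
apply: (@continuousM _ _ (fun t => f t i 0 * M i j)); last exact: continuous_coord.
by apply: continuousM; [exact: continuous_coord|exact: cvg_cst].
Qed.

Lemma is_derive_coord m n (f : R -> 'M[R]_(m, n)) (s : R) df i j :
  is_derive s 1 f df -> is_derive s 1 (fun t => f t i j) (df i j).
Proof.
move=> [dvf <-]; rewrite derive_mx // mxE; apply: derivableP.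
exact: (derivable_mxP _ _ _).1.
Qed.

Lemma is_derive_bform m n (M : 'M[R]_(m, n)) (f : R -> 'cV[R]_m)
    (g : R -> 'cV[R]_n) (s : R) df dg :
  is_derive s 1 f df -> is_derive s 1 g dg ->
  is_derive s 1 (fun t => bform M (f t) (g t))
    (bform M df (g s) + bform M (f s) dg).
Proof.
move=> Df Dg; under eq_fun do rewrite bformE.
rewrite !bformE -big_split /=.
have -> : (fun t => \sum_i \sum_j f t i 0 * M i j * g t j 0) =
    \sum_i \sum_j ((fun t => f t i 0 * M i j * g t j 0) : R -> R).
  apply/funext => t; rewrite fct_sumE; apply: eq_bigr => i _.
  by rewrite fct_sumE.
apply: is_derive_sum => i; rewrite -big_split /=; apply: is_derive_sum => j.
have Dfi := is_derive_coord i 0 Df; have Dgj := is_derive_coord j 0 Dg.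
have Dfm : is_derive s 1 (fun t => f t i 0 * M i j) (df i 0 * M i j).
  apply: (is_derive_eq (is_deriveM Dfi (is_derive_cst (M i j) s 1))).
  by rewrite scaler0 add0r [LHS]mulrC.
apply: (is_derive_eq (is_deriveM Dfm Dgj)).
by rewrite addrC /GRing.scale /= [g s _ _ * _]mulrC.
Qed.

End Calculus.

(** * Lyapunov decay on one sampling interval *)

Section SampleInterval.
Context {R : realType} {n : nat}.
Variables (P W : 'M[R]_n) (x y : R -> 'cV[R]_n) (a b h al : R).
Hypotheses (PP : posdefmx P) (PW : posdefmx W) (ab : a < b) (bah : b - a <= h).
Hypothesis xc : {within `[a, b], continuous x}.
Hypothesis yc : forall i, {within `[a, b], continuous (fun s => y s i 0)}.
Hypothesis xD : forall s, a < s < b -> is_derive s 1 x (y s).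

Let e s := x s - x a.

Let ec : {within `[a, b], continuous e}.
Proof. by move=> s; apply: continuousB; [exact: xc|exact: cvg_cst]. Qed.

(** Mean value theorem in each coordinate, the velocity being bounded on the compact interval. *)
Lemma increment_bound : exists C, forall s, a <= s <= b ->
  forall i, `|e s i 0| <= C * (s - a).
Proof.
have yb i : exists c, forall s, s \in `[a, b] -> `|y s i 0| <= c.
  have [c _ cP] := @EVT_max R (fun s => `|y s i 0|) a b (ltW ab) (fun s =>
    continuous_comp (@yc i s) (@norm_continuous _ _ _)).
  by exists `|y c i 0|.
have [c cP] := fin_all_exists yb.
exists (\sum_i `|c i|) => s /andP[as_ sb] i.
have xci : {within `[a, s], continuous (fun t => x t i 0)}.
  apply: continuous_subspaceW (continuous_coord (i := i) (j := 0) xc) => t.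
  rewrite /= !in_itv /=.
  by move=> /andP[-> /= ts]; rewrite (le_trans ts).
have xDi t : t \in `]a, s[ -> is_derive t 1 (fun r => x r i 0) (y t i 0).
  rewrite in_itv /= => /andP[at_ ts]; apply: is_derive_coord; apply: xD.
  by rewrite at_ (lt_le_trans ts).
have [t tas] := MVT_segment as_ xDi xci.
rewrite /e !mxE => ->; rewrite normrM [`|s - a|]ger0_norm ?subr_ge0 //.
rewrite ler_wpM2r ?subr_ge0 // (le_trans (cP i t _)) //.
  by move: tas; rewrite !in_itv /= => /andP[-> /= ts]; rewrite (le_trans ts).
rewrite (le_trans (ler_norm _)) // (bigD1 i) //= lerDl.
exact: sumr_ge0.
Qed.

Let q s := bform W (e s) (e s).

(** Only the left endpoint is delicate: there q is quadratic in s - a, so the quotient tends to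
    0. *)
Lemma quotient_continuous : {within `[a, b], continuous (fun s => (s - a)^-1 * q s)}.
Proof.
have qc : {within `[a, b], continuous q} by apply: continuous_bform.
have [_ _ qb] := (continuous_within_itvP _ ab).1 qc.
apply/(continuous_within_itvP _ ab); split.
- move=> s; rewrite in_itv /= => /andP[as_ sb].
  apply: (@continuousM _ _ (fun s => (s - a)^-1)); last first.
    by apply: (within_continuous_continuous ab qc); rewrite in_itv /= as_.
  apply: (@continuousV _ _ (fun s => s - a)); first by rewrite subr_eq0 gt_eqF.
  by apply: continuousB; [exact: cvg_id|exact: cvg_cst].
- have [C CP] := increment_bound.
  (* The convention 0^-1 = 0 makes the value at a equal to this limit. *)
  rewrite subrr invr0 mul0r.
  pose c := (\sum_i \sum_j `|W i j|) * C ^+ 2.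
  apply: (@squeeze_cvgr _ _ _ _ (fun=> 0) (fun s => c * (s - a))).
  + near=> s; have as_ : a < s by near: s; exact: nbhs_right_gt.
    have sb : s < b by near: s; exact: nbhs_right_lt.
    rewrite mulr_ge0 ?invr_ge0 ?subr_ge0 ?(ltW as_) ?posdefmx_ge0 //=.
    rewrite mulrC ler_pdivrMr ?subr_gt0 // (le_trans (ler_norm _)) //.
    rewrite (le_trans (bform_bound W (CP s _))) ?(ltW as_) ?(ltW sb) //.
    by rewrite exprMn [_ ^+ 2 * _]mulrA /c -!mulrA -expr2 lexx.
  + exact: cvg_cst.
  + have -> : 0 = c * (a - a) by rewrite subrr mulr0.
    apply: cvg_at_right_filter; apply: cvgM; first exact: cvg_cst.
    by apply: cvgB; [exact: cvg_id|exact: cvg_cst].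
- apply: cvgM; last exact: qb.
  apply: cvgV; first by rewrite subr_eq0 gt_eqF.
  apply: cvg_at_left_filter.
  by apply: cvgB; [exact: cvg_id|exact: cvg_cst].
Unshelve. all: by end_near. Qed.

                                                                      
(** For s > a the bracket is (h - tau) tau v^T W v. By Jensen it is a lower bound for (h - tau)
    times the integral of y^T W y, the usual looped functional, but it needs no integral. *)
Let V s := bform P (x s) (x s) + (h * ((s - a)^-1 * q s) - q s).

Hypothesis dissip : forall s v, a < s < b -> e s = (s - a) *: v ->
  2 * bform P (x s) (y s) + (h - (s - a)) * bform W (y s) (y s)
    - (s - a) * bform W v v
  <= - al * (bform P (x s) (x s) + (h - (s - a)) * (s - a) * bform W v v).

Lemma V_continuous : {within `[a, b], continuous V}.
Proof.
have pc := continuous_bform (M := P) xc xc.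
have qc := continuous_bform (M := W) ec ec.
move=> s; exact: (cvgD (pc s)
  (cvgB (cvgM (cvg_cst h) (quotient_continuous (x := s))) (qc s))).
Qed.

Lemma V_derive s : a < s < b ->
  exists2 dV, is_derive s 1 V dV & dV <= - al * V s.
Proof.
move=> asb; have /andP[as_ sb] := asb.
have tau0 : 0 < s - a by rewrite subr_gt0.
have De : is_derive s 1 e (y s).
  apply: (is_derive_eq (is_deriveB (xD asb) (is_derive_cst (x a) s 1))).
  by rewrite subr0.
have Dq := is_derive_bform W De De; have Dp := is_derive_bform P (xD asb) (xD asb).
have Dt : is_derive s 1 (fun t => (t - a)^-1) (- (s - a) ^- 2).
  have Dt : is_derive s 1 (fun t => t - a) 1.
    apply: (is_derive_eq (is_deriveB (is_derive_id s 1) (is_derive_cst a s 1))).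
    by rewrite subr0.
  have := is_deriveV (f := fun t => t - a) _ Dt.
  rewrite gt_eqF // => /(_ isT) D; apply: (is_derive_eq D).
  by rewrite /GRing.scale /= mulr1.
have DV := is_deriveD Dp (is_deriveB
  (is_deriveM (is_derive_cst h s 1) (is_deriveM Dt Dq)) Dq).
eexists; first exact: DV.
have [v ev] : exists v, e s = (s - a) *: v.
  by exists ((s - a)^-1 *: e s); rewrite scalerA mulfV ?scale1r // gt_eqF.
have := dissip asb ev.
rewrite /V /q (bform_sym (y s) (x s) PP.1) (bform_sym (y s) (e s) PW.1).
rewrite ev !bform_lin.
have hsa : 0 <= h - (s - a) by rewrite subr_ge0 (le_trans _ bah) // lerD2r ltW.
(* Expanding (y - v)^T W (y - v) >= 0 bounds the term 2 (h - tau) v^T W y produced by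
   differentiating V. *)
have := mulr_ge0 hsa (posdefmx_ge0 (y s - v) PW).
rewrite !bform_lin (bform_sym (y s) v PW.1).
rewrite /cst /GRing.scale /=.
set t := s - a in tau0 *; set pxy := bform P _ _; set pxx := bform P _ _.
set vv := bform W v v; set vy := bform W v _; set yy := bform W _ _.
have -> : t^-1 * (t * (t * vv)) = t * vv by field; rewrite gt_eqF.
move=> G D; rewrite mulr0 addr0.
have -> : t^-1 * (t * vy + t * vy) = 2 * vy by field; rewrite gt_eqF.
have -> : t * (t * vv) * - t ^- 2 = - vv by field; rewrite gt_eqF.
by lra.
Qed.

(** The function exp(al (t - a)) V(t) is nonincreasing. V agrees with the P-form at a and lies above
    it on the interval because s - a <= h. *)
Lemma interval_decay s : a <= s <= b ->
  bform P (x s) (x s) <= expR (- al * (s - a)) * bform P (x a) (x a).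
Proof.
move=> /andP[as_ sb].
pose f t := expR (al * (t - a)) * V t.
have Df t : t \in `]a, b[ -> exists2 df, is_derive t 1 f df & df <= 0.
  rewrite in_itv /= => /V_derive[dV DV dVle].
  have Dl : is_derive t 1 (fun t => al * (t - a)) al.
    apply: (is_derive_eq (is_deriveM (is_derive_cst al t 1)
      (is_deriveB (is_derive_id t 1) (is_derive_cst a t 1)))).
    by rewrite subr0 scaler0 addr0 /GRing.scale /= mulr1.
  have DE := @is_derive1_comp _ expR (fun t => al * (t - a)) t _ _
    (is_derive_expR _) Dl.
  eexists; first exact: (is_deriveM DE DV).
  have := mulr_ge0 (expR_ge0 (al * (t - a))) (_ : 0 <= - al * V t - dV).
  by rewrite subr_ge0 /GRing.scale /= => /(_ dVle); lra.
have fc : {within `[a, b], continuous f}.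
  have Ec : continuous (fun t : R => expR (al * (t - a))).
    move=> t; apply: continuous_comp; last exact: continuous_expR.
    apply: cvgM; first exact: cvg_cst.
    by apply: cvgB; [exact: cvg_id|exact: cvg_cst].
  have Ec' := continuous_subspaceT (A := `[a, b]) Ec.
  by move=> t; exact: (cvgM (Ec' t) (V_continuous (x := t))).
have fs : f s <= f a.
  apply: (@ler0_derive1_le_cc R f a b) => //.
  - by move=> t /Df[df []].
  - by move=> t /Df[df [_ <-]]; rewrite derive1E.
  - by rewrite in_itv /= as_ sb.
  - by rewrite in_itv /= lexx ltW.
have Va : V a = bform P (x a) (x a).
  by rewrite /V /q /e [x a - x a]subrr bform0l !mulr0 !subr0 addr0.
have Vs : bform P (x s) (x s) <= V s.
  have qs0 : 0 <= q s by exact: posdefmx_ge0.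
  rewrite /V lerDl subr_ge0.
  have [sa|sa] := eqVneq a s.
    by rewrite /q /e -sa [x a - x a]subrr bform0l !mulr0.
  have {}sa : 0 < s - a by rewrite subr_gt0 lt_neqAle sa.
  rewrite mulrA ler_peMl // ler_pdivlMr // mul1r (le_trans _ bah) //.
  by rewrite lerD2r.
rewrite (le_trans Vs) // mulNr expRN mulrC ler_pdivlMr ?expR_gt0 // mulrC.
by move: fs; rewrite /f subrr mulr0 expR0 mul1r Va.
Qed.

End SampleInterval.

(** * Remaining facts on definiteness and sampling times, and the theorem *)

Lemma posdefmx_inv (R : realType) n (M : 'M[R]_n) : posdefmx M -> posdefmx (invmx M).
Proof.
move=> PM; have uM := posdefmx_unitmx PM.
have sM : (invmx M)^T = invmx M by rewrite trmx_inv PM.1.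
split=> // v v0; rewrite -/(bform _ v v).
have -> : bform (invmx M) v v = bform M (invmx M *m v) (invmx M *m v).
  by rewrite bform_mull bform_mulr sM mulVmx // mul1mx.
apply: PM.2; apply: contraNneq v0 => E.
by rewrite -[v](mulKVmx uM) E mulmx0.
Qed.

Lemma posdefmx1 (R : realType) n : posdefmx (1%:M : 'M[R]_n).
Proof.
split=> [|v v0]; first exact: trmx1.
rewrite -/(bform _ v v) bformE.
have /existsP[i vi] : [exists i, v i 0 != 0].
  rewrite -negb_forall; apply: contra v0 => /forallP v0.
  by apply/eqP/matrixP => i j; rewrite ord1 mxE; apply/eqP; exact: v0.
have vE j : \sum_k v j 0 * 1%:M j k * v k 0 = v j 0 ^+ 2.
  rewrite (bigD1 j) //= big1 => [|k kj]; rewrite mxE.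
    by rewrite eqxx mulr1 addr0.
  by rewrite eq_sym (negbTE kj) mulr0 mul0r.
rewrite (bigD1 i) //= vE ltr_wpDr ?exprn_even_gt0 //.
by apply: sumr_ge0 => j _; rewrite vE sqr_ge0.
Qed.

Lemma sampling_cover (R : realType) (h : R) (t : nat -> R) (s : R) :
  sampling_sequence h t -> 0 <= s -> exists k, t k <= s <= t k.+1.
Proof.
move=> [t0 _ tlim] s0.
(* The first sampling time beyond s has positive index since t 0 = 0 <= s; its predecessor is the
   index sought. *)
have ex : exists k, s < t k.
  have /cvgryPgt/(_ s)[k _ kP] := tlim; exists k; exact: (kP k (leqnn k)).
case: (ex_minnP ex) => -[|k] sk kmin.
  by move: sk; rewrite t0 ltNge s0.
exists k; rewrite (ltW sk) andbT leNgt; apply/negP => /kmin.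
by rewrite ltnn.
Qed.

Theorem theorem5 (R : realType) (n m md N : nat)
  (hn : (0 < n)%N) (hm : (0 < m)%N) (hmd : (0 < md)%N) (hN : (0 < N)%N)
  (Xdot X : 'M[R]_(n, N)) (U : 'M[R]_(m, N))
  (Bd : 'M[R]_(n, md)) (hBd : \rank Bd = md)
  (Qd : 'M[R]_N) (Sd : 'M[R]_(N, md)) (Rd : 'M[R]_md)
  (hQd_sym : Qd^T = Qd) (hRd_sym : Rd^T = Rd) (hQd : negdefmx Qd)
  (Atr : 'M[R]_n) (Btr : 'M[R]_(n, m)) (Dhat : 'M[R]_(md, N))
  (hDhat : noise_set Qd Sd Rd Dhat)
  (hdata : Xdot = Atr *m X + Btr *m U + Bd *m Dhat)
  (hPc_inv : data_mx Xdot X U Bd Qd Sd Rd \in unitmx)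
  (hPc_eig : num_pos_eigenvalues (data_mx Xdot X U Bd Qd Sd Rd) = md)
  (K : 'M[R]_(m, n)) (h : R) (hh : 0 < h)
  (lambda1 lambda2 : R) (hlambda1 : 0 < lambda1) (hlambda2 : 0 < lambda2)
  (Q1 W : 'M[R]_n) (hQ1 : posdefmx Q1) (hW : posdefmx W)
  (Q2 Q3 : 'M[R]_n) (hQ3 : posdefmx (Q3 + Q3^T))
  (hG1 : negdefmx
     ((G1 W K h)^T
      *m inner_mx (block_mx Q1 0 Q2 Q3) W lambda1
           (data_mx Xdot X U Bd Qd Sd Rd)
      *m G1 W K h))
  (hG2 : negdefmx
     ((G2 K h)^T
      *m inner_mx (block_mx Q1 0 Q2 Q3) (invmx W) lambda2
           (data_mx Xdot X U Bd Qd Sd Rd)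
      *m G2 K h)) :
  forall (A : 'M[R]_n) (B : 'M[R]_(n, m)),
    consistent_systems Xdot X U Bd Qd Sd Rd (A, B) ->
  forall t : nat -> R, sampling_sequence h t ->
    exponentially_stable A B K t.
Proof.
move=> A B cAB t tsamp.
have [t0 tstep _] := tsamp.
have [al al0 diss] := sampled_dissipation hh hlambda1 hlambda2 hQ1 hW hQ3
  (fun p => consistent_data_mx_ge0 p cAB) hG1 hG2.
have PP := posdefmx_inv hQ1; set P := invmx Q1 in PP diss.
have [c1 c10 dom1] := posdefmx_dominates 1%:M PP.
have [c2 c20 dom2] := posdefmx_dominates P (posdefmx1 R n).
(* c1 and c2 compare the squared Euclidean norm with the P-form in both directions. Taking square
   roots of the decay of the P-form halves the rate. *)
exists (Num.sqrt (c1 * c2)), (al / 2); split.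
- by rewrite sqrtr_gt0 mulr_gt0.
- by rewrite divr_gt0.
move=> x u [xc uE xD] s s0.
have tk0 k : 0 <= t k.
  by elim: k => [|k IH]; [rewrite t0|have := tstep k; lra].
have step k r : t k <= r <= t k.+1 ->
    bform P (x r) (x r) <=
      expR (- al * (r - t k)) * bform P (x (t k)) (x (t k)).
  move=> rk; have /andP[tk tkh] := tstep k.
  (* The velocity with the control frozen at its value at t k: it is continuous up to t k.+1, where
     u itself may jump. *)
  pose y r := A *m x r + B *m (K *m x (t k)).
  have xck : {within `[t k, t k.+1], continuous x}.
    apply: continuous_subspaceW xc => q /=; rewrite !in_itv /= andbT.
    by move=> /andP[tkq _]; rewrite (le_trans _ tkq).
  apply: (interval_decay (y := y) (h := h) (W := W) (b := t k.+1)) => //.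
  - by rewrite -subr_gt0.
  - move=> i; have yE q : y q i 0 =
        bform A (delta_mx i 0) (x q) + (B *m (K *m x (t k))) i 0.
      rewrite /y mxE; congr (_ + _).
      by rewrite /bform trmx_delta -mulmxA -rowE [RHS]mxE.
    rewrite (funext yE).
    move=> q; apply: cvgD; last exact: cvg_cst.
    have cst_c : {within `[t k, t k.+1], continuous
      (fun=> delta_mx i 0 : 'cV[R]_n)} by move=> ?; exact: cvg_cst.
    exact: (continuous_bform (M := A) cst_c xck).
  - move=> q qk; have := xD k q qk; rewrite (uE k) //.
    by have /andP[q1 ->] := qk; rewrite (ltW q1).
  - move=> q v /andP[q1 q2] ev; apply: diss.
      rewrite subr_ge0 (ltW q1) /= (le_trans _ tkh) // lerD2r.
      exact: ltW.
    by rewrite -ev subKr.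
(* The interval estimates telescope, their exponents adding up to - al (t k). *)
have sampled k : bform P (x (t k)) (x (t k)) <=
    expR (- al * t k) * bform P (x 0) (x 0).
  elim: k => [|k IH]; first by rewrite t0 mulr0 expR0 mul1r.
  have /andP[tk _] := tstep k.
  apply: le_trans (step k _ _) _; first by rewrite lexx -subr_ge0 ltW.
  apply: le_trans (ler_wpM2l (expR_ge0 _) IH) _.
  by rewrite mulrA -expRD -mulrDr subrK.
have [k ksk] := sampling_cover tsamp s0.
have decay : bform P (x s) (x s) <= expR (- al * s) * bform P (x 0) (x 0).
  apply: le_trans (step k _ ksk) _.
  apply: le_trans (ler_wpM2l (expR_ge0 _) (sampled k)) _.
  by rewrite mulrA -expRD -mulrDr subrK.
have normE (v : 'cV[R]_n) : enorm v = Num.sqrt (bform 1%:M v v).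
  by rewrite /enorm /bform mulmx1.
have E0 : 0 <= expR (- (al / 2) * s) by exact: expR_ge0.
have EE : expR (- al * s) = expR (- (al / 2) * s) ^+ 2.
  by rewrite expr2 -expRD; congr expR; field.
rewrite !normE -(ger0_norm E0) -sqrtr_sqr -EE.
rewrite -sqrtrM ?mulr_ge0 ?(ltW c10) ?(ltW c20) //.
rewrite -sqrtrM ?mulr_ge0 ?expR_ge0 ?(ltW c10) ?(ltW c20) //.
rewrite ler_wsqrtr // (le_trans (dom1 _)) //.
rewrite -!mulrA ler_pM2l // (le_trans decay) // mulrCA ler_pM2l ?expR_gt0 //.
Qed.
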